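(* Let $\Omega\subset\mathbb{R}^n$ be a closed convex set with nonempty interior $\mathring\Omega$, let $\mathcal F$ be the Funk metric on $\mathring\Omega$ and let $p$ be its Lagrangian. For $t\in[0,1]$ let $\mathcal F_t^a(x,y)=(1-t)\mathcal F(x,y)+t\mathcal F(y,x)$ and $$p_t^a(x,v)=(1-t)p(x,v)+t\,p(x,-v).$$ Then $\mathcal F_t^a$ is the Finsler metric with Lagrangian $p_t^a$, that is, for all $x,y\in\mathring\Omega$, $$\mathcal F_t^a(x,y)=\inf_\gamma\int_a^b p_t^a(\gamma(s),\dot\gamma(s))\,ds,$$ the infimum being over all piecewise $C^1$-paths $\gamma\colon[a,b]\to\mathring\Omega$ from $x$ to $y$. Furthermore, straight line segments in $\mathring\Omega$ are minimal paths for $\mathcal F_t^a$, i.e. the infimum is attained by the straight line segment from $x$ to $y$.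
   Context: Let $\partial\Omega$ be the boundary of $\Omega$. For distinct $x,y\in\mathring\Omega$, let $R(x,y)$ be the ray with origin $x$ passing through $y$; if $R(x,y)\not\subset\Omega$, let $a^+$ be the unique intersection point of $R(x,y)$ with $\partial\Omega$. The Funk metric is $$\mathcal F(x,y)=\log\frac{|x-a^+|}{|y-a^+|}\ \text{ if } R(x,y)\not\subset\Omega,\qquad \mathcal F(x,y)=0\ \text{ if } R(x,y)\subset\Omega,$$ and $\mathcal F(x,x)=0$. Its Lagrangian is $p(x,v)=\inf\{s>0\mid x+\frac{v}{s}\in\Omega\}$ for $x\in\mathring\Omega$ and $v\in\mathbb R^n=T_x\mathring\Omega$, $v\neq0$, with $p(x,0)=0$; thus $p(x,v)=|v|/|x-a|$ if the ray from $x$ in direction $v$ meets $\partial\Omega$ at $a$, and $p(x,v)=0$ if this ray is contained in $\Omega$. *)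

(* Defs.v *)
From HB Require Import structures.
From mathcomp Require Import all_boot all_order all_algebra.
From mathcomp Require Import all_classical all_reals all_analysis.

Set Implicit Arguments.
Unset Strict Implicit.
Unset Printing Implicit Defensive.

Import Order.TTheory GRing.Theory Num.Theory.
Import numFieldNormedType.Exports.

Local Open Scope classical_set_scope.
Local Open Scope ring_scope.

Section Funk.
Context {R : realType} {n : nat}.
Implicit Types (Om D : set 'rV[R]_n) (x y v : 'rV[R]_n).

(* The norm provided by the library on 'rV[R]_n is the sup norm; it induces
   the usual topology, but the Euclidean length has to be written out. *)
Definition euclid_norm v : R := Num.sqrt (\sum_(i < n) v ord0 i ^+ 2).

Definition boundary Om : set 'rV[R]_n := closure Om `\` Om°.

Definition ray x y : set 'rV[R]_n :=
  [set x + s *: (y - x) | s in [set s : R | 0 <= s]].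

(* [get] picks the intersection point a^+ of the ray with the boundary, which
   is unique when Om is closed and convex, x, y are distinct interior points
   and the ray leaves Om. *)
Definition funk Om x y : R :=
  if x == y then 0
  else if `[< ray x y `<=` Om >] then 0
  else let a := get (ray x y `&` boundary Om) in
       ln (euclid_norm (x - a) / euclid_norm (y - a)).

Definition funk_lagrangian Om x v : R :=
  if v == 0 then 0
  else inf [set s : R | 0 < s /\ Om (x + s^-1 *: v)].

Definition funk_a Om (t : R) x y : R :=
  (1 - t) * funk Om x y + t * funk Om y x.

Definition funk_a_lagrangian Om (t : R) x v : R :=
  (1 - t) * funk_lagrangian Om x v + t * funk_lagrangian Om x (- v).

(* The derivative is taken relative to [c, d], hence it is one-sided at the
   endpoints. *)
Definition C1_on (c d : R) (g : R -> 'rV[R]_n) : Prop :=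
  exists dg : R -> 'rV[R]_n,
    {within `[c, d], continuous dg} /\
    forall s : R, s \in `[c, d] ->
      (u - s)^-1 *: (g u - g s) @[u --> within `[c, d] s^'] --> dg s.

(* With the library's [itv_partition], the subdivision points are a :: r,
   the last of which is b. *)
Definition piecewise_C1 (a b : R) (g : R -> 'rV[R]_n) : Prop :=
  {within `[a, b], continuous g} /\
  exists r : seq R, itv_partition a b r /\
    forall i, (i < size r)%N -> C1_on (nth b (a :: r) i) (nth b (a :: r) i.+1) g.

Definition path_from_to D x y (a b : R) (g : R -> 'rV[R]_n) : Prop :=
  [/\ a < b, piecewise_C1 a b g, (forall s, s \in `[a, b] -> D (g s)),
      g a = x & g b = y].

(* At the finitely many subdivision points derive1 g may be meaningless; they form
   a null set. *)
Definition path_length (p : 'rV[R]_n -> 'rV[R]_n -> R) (a b : R)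
    (g : R -> 'rV[R]_n) : \bar R :=
  (\int[lebesgue_measure]_(s in `[a, b]) (p (g s) (derive1 g s))%:E)%E.

Definition finsler_dist D (p : 'rV[R]_n -> 'rV[R]_n -> R) x y : \bar R :=
  ereal_inf [set l : \bar R | exists (a b : R) (g : R -> 'rV[R]_n),
    path_from_to D x y a b g /\ l = path_length p a b g].

Definition minimal_path D (p : 'rV[R]_n -> 'rV[R]_n -> R) x y (a b : R)
    (g : R -> 'rV[R]_n) : Prop :=
  path_from_to D x y a b g /\ path_length p a b g = finsler_dist D p x y.

Definition segment x y (s : R) : 'rV[R]_n := x + s *: (y - x).

End Funk.

(* Main.v *)
Require Import Defs.
From HB Require Import structures.
From mathcomp Require Import all_boot all_order all_algebra.
From mathcomp Require Import all_classical all_reals all_analysis.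
From mathcomp Require Import measurable_realfun ring lra.

Set Implicit Arguments.
Unset Strict Implicit.
Unset Printing Implicit Defensive.

Import Order.TTheory GRing.Theory Num.Theory.
Import numFieldNormedType.Exports.

Local Open Scope classical_set_scope.
Local Open Scope ring_scope.

(** The proof is a calibration argument: it exhibits an exact 1-form that
minorizes the Lagrangian and agrees with it along the given segment.

For an interior point x the Lagrangian v |-> p x v is the gauge of Om seen from
x, hence sublinear, and, Om being closed, x + s v is in Om exactly when
s * p x v <= 1.  So the ray from x through y leaves Om, if at all, at parameter
1 / p x (y - x), and in all cases

   funk Om x y = - ln (1 - p x (y - x))                         ([funkE]).

By Hahn-Banach there is a linear form L with L <= p x and
L (y - x) = p x (y - x) ([hahn_banach_rV]).  Put D z = 1 - L (z - x).  Since
p x (z - x) <= 1 on Om, the affine function D is nonnegative on Om and positive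
on its interior; when the ray leaves Om, D = 0 is a supporting hyperplane at the
exit point.  Nonnegativity of D at z + v / s yields L v / D z <= p z v, with
equality when z is on the segment from x to y and v = y - x ([calibration]).
Now L v / D z is the derivative of - ln D at z in direction v, and
ln (D x) - ln (D y) = funk Om x y.  Working with a ray that stays in Om needs no
separate treatment: there L (y - x) = 0.

Doing the same for the pair (y, x), with direction - v, and taking the convex
combination of the two gives a function H on the interior such that
H y - H x = funk_a Om t x y, and whose derivative is at most the Lagrangian, with
equality along the segment ([funk_a_potential]).  Integrating along a path by the
fundamental theorem of calculus proves that its length is at least
funk_a Om t x y ([le_path_length]), and that the segment has exactly this length
([segment_length]).  The speed of a path is not shown to be measurable; the lower
bound is obtained by integrating a measurable minorant of it, built piece by
piece ([le_integral_piecewise]). *)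

(** * Sublinear functions and the Hahn-Banach theorem *)

Section Sublinear.
Context {R : realType} {V : lmodType R}.
Implicit Types (q : V -> R) (u v w : V).

(** Subadditive and positively homogeneous. Homogeneity is only required as an
inequality and for positive scalars; equality and [q 0 = 0] follow. *)
Definition sublinear q :=
  (forall u v, q (u + v) <= q u + q v) /\
  (forall (k : R) u, 0 < k -> q (k *: u) <= k * q u).

Lemma sublinearZ q k u : sublinear q -> 0 < k -> q (k *: u) = k * q u.
Proof.
move=> [_ qZ] k0; apply/eqP; rewrite eq_le qZ//=.
have ki0 : 0 < k^-1 by rewrite invr_gt0.
have := qZ _ (k *: u) ki0.
by rewrite scalerA mulVf ?gt_eqF// scale1r mulrC ler_pdivlMr// mulrC.
Qed.

Lemma sublinear0 q : sublinear q -> q 0 = 0.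
Proof.
move=> sq; have := @sublinearZ q 2 0 sq (ltr0Sn _ _).
by rewrite scaler0 => h; lra.
Qed.

Lemma sublinearZ_ge0 q k u : sublinear q -> 0 <= k -> q (k *: u) = k * q u.
Proof.
move=> sq; rewrite le_eqVlt => /predU1P[<-|]; last exact: sublinearZ.
by rewrite scale0r mul0r sublinear0.
Qed.

Lemma sublinear_subN q u : sublinear q -> 0 <= q u + q (- u).
Proof. by move=> sq; rewrite -(sublinear0 sq) -(subrr u) sq.1. Qed.

(** The largest sublinear minorant of [q] that is linear on the line spanned by
[w] with the same value as [q] at [w]. *)
Definition flatten_along q w u : R :=
  inf [set q (u + s *: w) - s * q w | s in [set s : R | 0 <= s]].

Lemma flatten_along_le q w u s : sublinear q -> 0 <= s ->
  flatten_along q w u <= q (u + s *: w) - s * q w.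
Proof.
move=> sq s0; apply: ge_inf; last by exists s.
exists (- q (- u)) => _ [r r0 <-].
have := sq.1 (u + r *: w) (- u).
by rewrite addrAC subrr add0r (sublinearZ_ge0 _ sq r0); lra.
Qed.

Lemma le_flatten_along q w u m :
  (forall s, 0 <= s -> m <= q (u + s *: w) - s * q w) ->
  m <= flatten_along q w u.
Proof.
move=> h; apply: lb_le_inf => [|_ [s s0 <-]]; last exact: h.
by exists (q (u + 0 *: w) - 0 * q w), 0 => /=.
Qed.

Lemma flatten_along_sublinear q w : sublinear q -> sublinear (flatten_along q w).
Proof.
move=> sq; split=> [u v|k u k0].
  rewrite -lerBlDr; apply: le_flatten_along => s s0.
  rewrite lerBlDr -lerBlDl; apply: le_flatten_along => r r0.
  have := flatten_along_le w (u + v) sq (addr_ge0 s0 r0).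
  have := sq.1 (u + s *: w) (v + r *: w).
  by rewrite scalerDl addrACA; lra.
rewrite mulrC -ler_pdivrMr//; apply: le_flatten_along => s s0.
rewrite ler_pdivrMr//.
have := flatten_along_le w (k *: u) sq (mulr_ge0 (ltW k0) s0).
rewrite -scalerA -scalerDr (sublinearZ _ sq k0) => /le_trans; apply.
by rewrite le_eqVlt; apply/orP; left; apply/eqP; ring.
Qed.

Lemma flatten_along_le_self q w u : sublinear q -> flatten_along q w u <= q u.
Proof.
by move=> sq; have := flatten_along_le w u sq (lexx 0);
rewrite scale0r addr0 mul0r subr0.
Qed.

Lemma flatten_alongN q w : sublinear q ->
  flatten_along q w (- w) <= - q w.
Proof.
move=> sq; have := flatten_along_le w (- w) sq ler01.
by rewrite scale1r addNr sublinear0// sub0r mul1r.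
Qed.

(** Linearity on a line is inherited by sublinear minorants: flattening along
further directions does not destroy what was gained before. *)
Lemma sublinear_minorant_odd q u p : sublinear p -> (forall v, p v <= q v) ->
  q (- u) = - q u -> p u = q u /\ p (- u) = - q u.
Proof.
move=> sp pq qu; have := sublinear_subN u sp.
have := pq u; have := pq (- u); rewrite qu => h1 h2 h3.
by split; apply/eqP; rewrite eq_le; apply/andP; split; lra.
Qed.

Lemma flatten_along_seq q (s : seq V) : sublinear q ->
  exists p, [/\ sublinear p, forall u, p u <= q u &
    forall u, u \in s -> p (- u) = - p u].
Proof.
move=> sq; elim: s => [|w s [p [sp pq ps]]]; first by exists q.
exists (flatten_along p w); split.
- exact: flatten_along_sublinear.
- by move=> u; apply: le_trans (pq u); exact: flatten_along_le_self.
- have sf := flatten_along_sublinear w sp.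
  move=> u; rewrite inE => /predU1P[->|/ps pu].
    have := flatten_alongN w sp; have := flatten_along_le_self w w sp.
    have := sublinear_subN w sf => h1 h2 h3.
    by apply/eqP; rewrite eq_le; apply/andP; split; lra.
  by have [-> ->] := sublinear_minorant_odd sf
    (fun u => flatten_along_le_self w u sp) pu.
Qed.

Lemma sublinear_sum q (I : finType) (F : I -> V) : sublinear q ->
  q (\sum_i F i) <= \sum_i q (F i).
Proof.
move=> sq; elim/big_ind2 : _ => //; first by rewrite sublinear0.
by move=> a b c d ab cd; apply: le_trans (sq.1 _ _) _; exact: lerD.
Qed.

End Sublinear.

(** Flattening [q] along [v] and then along the vectors of the standard basis
leaves a sublinear function that is linear on each coordinate axis, and such a
function is linear. *)
Lemma hahn_banach_rV (R : realType) n (q : 'rV[R]_n -> R) (v : 'rV[R]_n) :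
  sublinear q -> exists c : 'cV[R]_n,
    (forall u, (u *m c) 0 0 <= q u) /\ (v *m c) 0 0 = q v.
Proof.
move=> sq; have sv := flatten_along_sublinear v sq.
pose q1 := flatten_along q v.
have q1q u : q1 u <= q u by exact: flatten_along_le_self.
have [q1v q1Nv] : q1 v = q v /\ q1 (- v) = - q v.
  have := flatten_alongN v sq; have := q1q v; have := sublinear_subN v sv.
  rewrite -/q1 => h1 h2 h3.
  by split; apply/eqP; rewrite eq_le; apply/andP; split; lra.
have [p [sp pq1 podd]] := flatten_along_seq [seq delta_mx 0 i | i : 'I_n] sv.
have pv : p v = q v.
  by rewrite -q1v; apply: (sublinear_minorant_odd sp pq1 _).1; rewrite -/q1 q1v.
have pe i : p (- delta_mx 0 i) = - p (delta_mx 0 i).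
  by apply: podd; apply/mapP; exists i => //; rewrite mem_enum.
have peZ k i : p (k *: delta_mx 0 i) = k * p (delta_mx 0 i).
  have [k0|k0] := leP 0 k; first by rewrite sublinearZ_ge0.
  rewrite -[k in LHS]opprK scaleNr -scalerN sublinearZ_ge0 ?oppr_ge0 1?ltW//.
  by rewrite pe mulrNN.
pose c : 'cV[R]_n := \col_i p (delta_mx 0 i).
have cE u : (u *m c) 0 0 = \sum_i u 0 i * p (delta_mx 0 i).
  by rewrite !mxE; apply: eq_bigr => i _; rewrite mxE.
have ple u : p u <= (u *m c) 0 0.
  rewrite cE {1}(row_sum_delta u); apply: le_trans (sublinear_sum _ sp) _.
  by apply: ler_sum => i _; rewrite peZ.
have pE u : p u = (u *m c) 0 0.
  apply/eqP; rewrite eq_le ple/=.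
  have := ple (- u); rewrite mulNmx mxE; have := sublinear_subN u sp; lra.
by exists c; split=> [u|]; rewrite -pE//; exact: le_trans (pq1 u) (q1q u).
Qed.

(** * The Funk Lagrangian as a gauge *)

Lemma homothety_continuous (R : realType) (V : normedModType R) (k : R) (w : V) :
  continuous (fun z => k *: (z - w)).
Proof.
by move=> z; apply: cvgZ; [exact: cvg_cst|apply: cvgB => //; exact: cvg_cst].
Qed.

Lemma line_continuous (R : realType) (V : normedModType R) (x v : V) :
  continuous (fun s : R => x + s *: v).
Proof. by move=> s; apply: cvgD; [exact: cvg_cst|exact: cvgZr_tmp]. Qed.

Section Lagrangian.
Context {R : realType} {n : nat}.
Variable Om : set 'rV[R]_n.
Hypothesis Om_convex : convex_set (Om : set (convex_lmodType 'rV[R]_n)).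
Implicit Types (x y z u v : 'rV[R]_n) (r s k : R).

Local Notation p := (funk_lagrangian Om).

Let conv_mem x y r : Om x -> Om y -> 0 <= r <= 1 ->
  Om (x + r *: (y - x)).
Proof.
move=> Omx Omy /andP[r0 r1].
have := Om_convex (Itv01 r0 r1) (mem_set Omy) (mem_set Omx).
rewrite inE; congr Om.
by rewrite /conv/= scalerBl scale1r scalerBr addrCA.
Qed.

Lemma funk_lagrangian_ge0 x v : 0 <= p x v.
Proof.
rewrite /funk_lagrangian; case: ifP => // _; set S := [set s | _].
have [->|/set0P S0] := eqVneq S set0; first by rewrite inf0.
by apply: lb_le_inf => // s [/ltW].
Qed.

Lemma convex_interior x y r : Om° x -> Om y -> 0 <= r < 1 ->
  Om° (x + r *: (y - x)).
Proof.
move=> Omx Omy /andP[r0 r1].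
have r1' : 0 < 1 - r by rewrite subr_gt0.
(* [h] is the inverse of the homothety z |-> z + r (y - z), which maps Om into
   itself; the preimage by [h] of a neighborhood of x inside Om
   is a neighborhood of x + r (y - x) inside Om. *)
pose h z := (1 - r)^-1 *: (z - r *: y).
have hx : h (x + r *: (y - x)) = x.
  rewrite /h [r *: (y - x)]scalerBr addrCA addrAC subrr add0r.
  rewrite -{1}(scale1r x) -scalerBl scalerA.
  by rewrite mulVf ?scale1r// gt_eqF.
have ch : h z @[z --> x + r *: (y - x)] --> h (x + r *: (y - x)) :=
  @homothety_continuous _ _ (1 - r)^-1 (r *: y) (x + r *: (y - x)).
have : \forall z \near x + r *: (y - x), Om (h z) by apply: ch; rewrite hx.
suff hS z : Om (h z) -> Om z by apply: filterS => z /hS.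
move=> Omhz.
have -> : z = h z + r *: (y - h z).
  rewrite scalerBr addrCA -{1}(scale1r (h z)) -scalerBl /h scalerA.
  by rewrite mulfV ?gt_eqF// scale1r addrC subrK.
by apply: conv_mem => //; rewrite r0 ltW.
Qed.

Lemma segment_interior x y s : Om° x -> Om° y -> 0 <= s <= 1 ->
  Om° (segment x y s).
Proof.
move=> Omx Omy /andP[s0]; rewrite /segment le_eqVlt => /predU1P[->|s1].
  by rewrite scale1r addrC subrK.
by apply: convex_interior; [|exact: interior_subset|rewrite s0].
Qed.

Section at_a_point.
Variable x : 'rV[R]_n.
Hypothesis Omx : Om° x.

Let S v := [set s : R | 0 < s /\ Om (x + s^-1 *: v)].

Lemma interior_absorbing v : exists2 s, 0 < s & Om (x + s *: v).
Proof.
have : x + s *: v @[s --> (0 : R)] --> x + (0 : R) *: v :=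
  @line_continuous _ _ x v 0.
rewrite scale0r addr0 => /(_ _ Omx) /= /nbhs_ballP[e /= e0 he].
exists (e / 2); first by rewrite divr_gt0.
apply: he.
by rewrite /ball/= sub0r normrN gtr0_norm ?divr_gt0// ltr_pdivrMr// ltr_pMr//
  ltr1n.
Qed.

Let S_neq0 v : S v !=set0.
Proof.
have [s s0 Oms] := interior_absorbing v.
exists s^-1; split; first by rewrite invr_gt0.
by rewrite invrK.
Qed.

Let S_lb v : has_lbound (S v).
Proof. by exists 0 => s [/ltW]. Qed.

(** The set defining the Lagrangian also gives the right value at [v = 0]. *)
Lemma funk_lagrangianE v : p x v = inf (S v).
Proof.
rewrite /funk_lagrangian; case: eqVneq => // ->; apply/eqP; rewrite eq_le.
apply/andP; split; first by apply: lb_le_inf => // s [/ltW].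
apply/ler_addgt0Pl => e e0; rewrite addr0.
apply: ge_inf => //; split => //.
by rewrite scaler0 addr0; exact: interior_subset.
Qed.

Lemma funk_lagrangian_le v s : 0 < s -> Om (x + s^-1 *: v) -> p x v <= s.
Proof. by move=> s0 Oms; rewrite funk_lagrangianE; exact: ge_inf. Qed.

Lemma le_funk_lagrangian v m :
  (forall s, 0 < s -> Om (x + s^-1 *: v) -> m <= s) -> m <= p x v.
Proof.
by move=> h; rewrite funk_lagrangianE; apply: lb_le_inf => // s [s0 Oms]; exact: h.
Qed.

Lemma funk_lagrangian_sublinear : sublinear (p x).
Proof.
split=> [u v|k u k0].
  (* x + (u + v) / (s + r) is a convex combination of x + u / s and x + v / r *)
  rewrite -lerBlDr; apply: le_funk_lagrangian => s s0 Oms.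
  rewrite lerBlDr -lerBlDl; apply: le_funk_lagrangian => r r0 Omr.
  rewrite lerBlDl; have sr0 : 0 < s + r by rewrite addr_gt0.
  apply: funk_lagrangian_le => //.
  have := @conv_mem _ _ (r / (s + r)) Oms Omr.
  rewrite divr_ge0 ?(ltW sr0) ?(ltW r0)//= ler_pdivrMr// mul1r lerDr (ltW s0).
  move=> /(_ isT); congr Om.
  rewrite opprD addrACA subrr add0r -addrA; congr (x + _).
  rewrite scalerBr addrA addrAC !scalerA -scalerBl scalerDr.
  congr (_ *: _ + _ *: _).
    by field; rewrite !gt_eqF.
  by field; rewrite !gt_eqF.
rewrite mulrC -ler_pdivrMr//; apply: le_funk_lagrangian => s s0 Oms.
rewrite ler_pdivrMr//; apply: funk_lagrangian_le; first exact: mulr_gt0.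
by rewrite scalerA invfM mulfVK// gt_eqF.
Qed.

Lemma funk_lagrangian_le1 v : Om (x + v) -> p x v <= 1.
Proof. by move=> ?; apply: funk_lagrangian_le; rewrite ?ltr01// invr1 scale1r. Qed.

Lemma funk_lagrangian_lt1 v : Om° (x + v) -> p x v < 1.
Proof.
move=> Omv.
have : x + s *: v @[s --> (1 : R)] --> x + (1 : R) *: v :=
  @line_continuous _ _ x v 1.
rewrite scale1r => /(_ _ Omv) /= /nbhs_ballP[e /= e0 he].
have : Om (x + (1 + e / 2) *: v).
  apply: he.
  rewrite /ball/= opprD addrA subrr sub0r normrN gtr0_norm ?divr_gt0//.
  by rewrite ltr_pdivrMr// ltr_pMr// ltr1n.
have k1 : 1 < 1 + e / 2 by rewrite ltrDl divr_gt0.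
move/funk_lagrangian_le1; rewrite (sublinearZ _ funk_lagrangian_sublinear);
  last exact: lt_trans k1.
rewrite mulrC -ler_pdivlMr ?(lt_trans ltr01)// mul1r => /le_lt_trans; apply.
by rewrite invf_lt1// (lt_trans ltr01).
Qed.

Lemma funk_lagrangian_lt1_interior v : p x v < 1 -> Om° (x + v).
Proof.
rewrite funk_lagrangianE => /inf_lt[//|s [s0 Oms] s1].
have := convex_interior Omx Oms (_ : 0 <= s < 1).
rewrite (ltW s0) s1 => /(_ isT).
by rewrite addrAC subrr add0r scalerA mulfV ?gt_eqF// scale1r.
Qed.

Lemma funk_lagrangian_le1_closed v : closed Om -> p x v <= 1 -> Om (x + v).
Proof.
move=> Om_closed pv1.
have : (x + s *: v) @[s --> (1 : R)^'-] --> x + (1 : R) *: v.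
  exact: cvg_at_left_filter (@line_continuous _ _ x v 1).
rewrite scale1r; apply: closed_cvg => //; near=> s; apply: (@interior_subset _ Om).
apply: funk_lagrangian_lt1_interior.
have s0 : 0 < s by near: s; exact: nbhs_left_gt.
have s1 : s < 1 by near: s; exact: nbhs_left_lt.
rewrite (sublinearZ _ funk_lagrangian_sublinear)//.
by apply: le_lt_trans s1; rewrite ger_pMr.
Unshelve. all: by end_near. Qed.

End at_a_point.
End Lagrangian.

(** * The Funk metric and its calibrations *)

Lemma euclid_normZ (R : realType) n (k : R) (v : 'rV[R]_n) :
  euclid_norm (k *: v) = `|k| * euclid_norm v.
Proof.
rewrite /euclid_norm; under eq_bigr do rewrite mxE exprMn.
by rewrite -mulr_sumr sqrtrM ?sqr_ge0// sqrtr_sqr.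
Qed.

Lemma euclid_norm_gt0 (R : realType) n (v : 'rV[R]_n) :
  v != 0 -> 0 < euclid_norm v.
Proof.
move=> v0; rewrite /euclid_norm sqrtr_gt0 lt_neqAle sumr_ge0 ?andbT; last first.
  by move=> i _; exact: sqr_ge0.
rewrite eq_sym psumr_eq0 => [|i _]; last exact: sqr_ge0.
apply: contra v0 => /allP vi; apply/eqP/rowP => i; rewrite mxE.
by have := vi i (mem_index_enum i); rewrite sqrf_eq0 => /eqP.
Qed.

Section Calibration.
Context {R : realType} {n : nat}.
Variable Om : set 'rV[R]_n.
Hypothesis Om_closed : closed Om.
Hypothesis Om_convex : convex_set (Om : set (convex_lmodType 'rV[R]_n)).
Implicit Types (x y z u v : 'rV[R]_n).

Local Notation p := (funk_lagrangian Om).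

Lemma ray_mem x v s : Om° x -> 0 <= s -> Om (x + s *: v) <-> s * p x v <= 1.
Proof.
move=> Omx s0.
rewrite -(sublinearZ_ge0 _ (funk_lagrangian_sublinear Om_convex Omx))//.
split; first exact: funk_lagrangian_le1.
by move=> h; exact: funk_lagrangian_le1_closed.
Qed.

Lemma ray_mem_interior x v s : Om° x -> 0 <= s ->
  Om° (x + s *: v) <-> s * p x v < 1.
Proof.
move=> Omx s0.
rewrite -(sublinearZ_ge0 _ (funk_lagrangian_sublinear Om_convex Omx))//.
split; first exact: funk_lagrangian_lt1.
by move=> h; exact: funk_lagrangian_lt1_interior.
Qed.

Lemma ray_boundary x y : Om° x -> 0 < p x (y - x) ->
  ray x y `&` boundary Om = [set x + (p x (y - x))^-1 *: (y - x)].
Proof.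
move=> Omx p0; rewrite /boundary.
have <- : Om = closure Om by exact/closure_id.
apply/seteqP; split=> [_ [[s s0 <-] [Oms Omis]]|_ ->] /=.
  have /(ray_mem _ Omx s0) := Oms; rewrite le_eqVlt => /predU1P[sp|].
    by rewrite -(mulr1 _^-1) -sp mulrC mulfK// gt_eqF.
  by move/(ray_mem_interior _ Omx s0).
have pi0 : 0 <= (p x (y - x))^-1 by rewrite invr_ge0 ltW.
split; first by exists (p x (y - x))^-1.
split; first by apply/ray_mem => //; rewrite mulVf// gt_eqF.
by move/(ray_mem_interior _ Omx pi0); rewrite mulVf ?ltxx// gt_eqF.
Qed.

Lemma funkE x y : Om° x -> Om° y -> funk Om x y = - ln (1 - p x (y - x)).
Proof.
move=> Omx Omy; rewrite /funk; case: eqVneq => [->|xy].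
  rewrite subrr (sublinear0 (funk_lagrangian_sublinear Om_convex Omy)).
  by rewrite subr0 ln1 oppr0.
have [p0|p0] := eqVneq (p x (y - x)) 0.
  rewrite p0 subr0 ln1 oppr0 asboolT//.
  by move=> _ [s s0 <-]; apply/ray_mem => //; rewrite p0 mulr0.
have {p0}p0 : 0 < p x (y - x).
  by rewrite lt_neqAle eq_sym p0; exact: funk_lagrangian_ge0.
have p1 : p x (y - x) < 1.
  by apply: funk_lagrangian_lt1 => //; rewrite addrC subrK.
rewrite asboolF; last first.
  (* twice the exit parameter gives a point of the ray outside Om *)
  move=> /(_ (x + (2 / p x (y - x)) *: (y - x))).
  have h : 0 <= 2 / p x (y - x) by rewrite divr_ge0 ?ler0n// ltW.
  have hr : ray x y (x + (2 / p x (y - x)) *: (y - x)).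
    by exists (2 / p x (y - x)).
  move=> /(_ hr) /(ray_mem _ Omx h).
  by rewrite mulfVK ?gt_eqF// leNgt ltr1n.
rewrite /= ray_boundary//.
have -> : get [set x + (p x (y - x))^-1 *: (y - x)] =
    x + (p x (y - x))^-1 *: (y - x).
  exact: get_unique.
set q := p x (y - x).
have yx : y - (x + q^-1 *: (y - x)) = (1 - q^-1) *: (y - x).
  by rewrite scalerBl scale1r opprD addrA.
have xx : x - (x + q^-1 *: (y - x)) = (- q^-1) *: (y - x).
  by rewrite scaleNr opprD addrA subrr add0r.
have yx0 : 0 < euclid_norm (y - x).
  by apply: euclid_norm_gt0; rewrite subr_eq0 eq_sym.
have qi1 : 1 < q^-1 by rewrite -[1]invr1 ltf_pV2// posrE.
rewrite xx yx !euclid_normZ normrN gtr0_norm ?invr_gt0// ltr0_norm ?subr_lt0//.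
rewrite opprB -lnV ?posrE ?subr_gt0//; congr ln.
by field; rewrite !gt_eqF//= subr_gt0.
Qed.

(** The witness [c] is the column of a linear form [L] that minorizes [p x] and
agrees with it at [y - x]; it may be zero when the ray stays in Om. *)
Lemma calibration x y : Om° x -> Om° y -> exists c : 'cV[R]_n,
  let L u := (u *m c) 0 0 in let D z := 1 - L (z - x) in
  [/\ forall z, Om° z -> 0 < D z,
      forall z u, Om° z -> L u / D z <= p z u,
      forall s, 0 <= s <= 1 ->
        p (segment x y s) (y - x) = L (y - x) / D (segment x y s) &
      funk Om x y = ln (D x) - ln (D y)].
Proof.
move=> Omx Omy; have sp := funk_lagrangian_sublinear Om_convex Omx.
have [c [Lp Lv]] := hahn_banach_rV (y - x) sp; exists c => L D.
have LD u w : L (u + w) = L u + L w by rewrite /L mulmxDl mxE.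
have LZ k u : L (k *: u) = k * L u by rewrite /L -scalemxAl mxE.
have DD z k u : D (z + k *: u) = D z - k * L u.
  by rewrite /D addrAC [L (z - x + _)]LD LZ opprD addrA.
have D_ge0 z : Om z -> 0 <= D z.
  move=> Omz; rewrite subr_ge0 (le_trans (Lp _))//.
  by apply: funk_lagrangian_le1 => //; rewrite addrC subrK.
have D_gt0 z : Om° z -> 0 < D z.
  move=> Omz; rewrite subr_gt0 (le_lt_trans (Lp _))//.
  by apply: funk_lagrangian_lt1 => //; rewrite addrC subrK.
have Lp' z u : Om° z -> L u / D z <= p z u.
  move=> Omz; apply: le_funk_lagrangian => // s s0 /D_ge0.
  rewrite DD subr_ge0 => h.
  by rewrite ler_pdivrMr ?D_gt0// -ler_pdivrMl.
split=> // [s s01|].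
  have Oms : Om° (segment x y s) by exact: segment_interior.
  apply/eqP; rewrite eq_le Lp'// andbT.
  have Ds : D (segment x y s) = 1 - s * p x (y - x).
    by rewrite /segment DD /D subrr {1}/L mul0mx mxE subr0 /L Lv.
  have D0 := D_gt0 _ Oms; rewrite Ds in D0 *.
  rewrite /L Lv; set q := p x (y - x) in D0 *.
  (* the margin e makes r positive even when the ray stays in Om and q = 0 *)
  apply/ler_addgt0Pr => e e0; set r := _ + e.
  have rq : q / (1 - s * q) < r by rewrite ltrDl.
  have r0 : 0 < r.
    apply: le_lt_trans rq; rewrite divr_ge0 ?(ltW D0)//.
    exact: funk_lagrangian_ge0.
  apply: funk_lagrangian_le => //.
  rewrite /segment -addrA -scalerDl; apply/ray_mem => //.
    by rewrite addr_ge0 ?invr_ge0 ?(ltW r0)//; case/andP: s01.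
  rewrite -/q mulrDl addrC -lerBrDr mulrC ler_pdivrMr// mulrC.
  by rewrite -ler_pdivrMr// ltW.
rewrite funkE// /D subrr /L mul0mx mxE subr0 ln1 sub0r.
by rewrite Lv.
Qed.

End Calibration.

(** * Integrals of pointwise bounds on derivatives *)

Section Integration.
Context {R : realType}.
Local Notation mu := (@lebesgue_measure R).
Implicit Types (a b c s : R) (f h : R -> R).

(** Monotonicity of the integral of nonnegative functions needs no
measurability: the integral is a supremum over simple functions below. *)
Lemma ge0_le_integral_nonmeasurable d (T : measurableType d)
    (m : {measure set T -> \bar R}) (D : set T) (f1 f2 : T -> \bar R) :
  (forall z, D z -> (0 <= f1 z)%E) -> (forall z, D z -> (f1 z <= f2 z)%E) ->
  (\int[m]_(z in D) f1 z <= \int[m]_(z in D) f2 z)%E.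
Proof.
move=> f10 f12; have f20 z : D z -> (0 <= f2 z)%E.
  by move=> Dz; apply: le_trans (f12 _ Dz); exact: f10.
rewrite !ge0_integralE//; apply: le_ereal_sup => _ [k kf1 <-]; exists k => // z.
apply: le_trans (kf1 z) _; rewrite /patch; case: ifPn => // /set_mem; exact: f12.
Qed.

Lemma integral_derivative a b h dh : a < b ->
  {within `[a, b], continuous h} -> {within `[a, b], continuous dh} ->
  (forall s, s \in `]a, b[ -> is_derive s 1 h (dh s)) ->
  (\int[mu]_(s in `[a, b]) (dh s)%:E = (h b - h a)%:E)%E.
Proof.
move=> ab ch cdh hdh; rewrite (continuous_FTC2 (F := h))//.
  have /continuous_within_itvP-/(_ ab)[_ ha hb] := ch.
  by split => // s /hdh[].
by move=> s /hdh[_ <-]; rewrite derive1E.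
Qed.

(** The step for one piece: the positive part of [dh], cut off outside [`]a, b[]
so that the minorants of adjacent pieces can be added. *)
Lemma positive_part_minorant a b h dh f : a < b ->
  {within `[a, b], continuous h} -> {within `[a, b], continuous dh} ->
  (forall s, s \in `]a, b[ -> is_derive s 1 h (dh s) /\ dh s <= f s) ->
  (forall s, 0 <= f s) ->
  exists k : R -> R, [/\ measurable_fun setT k,
    forall s, 0 <= k s <= (f \_ `]a, b[) s &
    ((h b - h a)%:E <= \int[mu]_s (k s)%:E)%E].
Proof.
move=> ab ch cdh hdh f0.
pose dp s := Num.max (dh s) 0.
have cdp : {within `[a, b], continuous dp}.
  move=> s; apply: (@continuous_max R (subspace `[a, b])
    (dh : subspace `[a, b] -> R^o) (cst 0) s (cdh s)).
  exact: cvg_cst.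
have mdp : measurable_fun `]a, b[ dp.
  apply: measurable_funS (subspace_continuous_measurable_fun _ cdp) => //.
  exact: subset_itv_oo_cc.
exists (dp \_ `]a, b[); split.
- by apply/(measurable_restrictT _ _).1.
- move=> s; rewrite /patch; case: ifPn => [/set_mem/= sab|_]; last by rewrite lexx.
  by rewrite le_max lexx orbT/= ge_max f0 (hdh _ sab).2.
- rewrite -(integral_derivative ab ch cdh (fun s sab => (hdh s sab).1)).
  have -> : (\int[mu]_s ((dp \_ `]a, b[) s)%:E =
             \int[mu]_(s in `[a, b]) (dp s)%:E)%E.
    rewrite [RHS]integral_itv_bndoo; last exact/measurable_EFinP.
    rewrite [RHS]integral_mkcond; apply: eq_integral => s _.
    by rewrite /patch; case: ifP.
  apply: le_integral => //.
  + by apply: (@continuous_compact_integrable _ dh) => //; exact: segment_compact.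
  + by apply: (@continuous_compact_integrable _ dp) => //; exact: segment_compact.
  + by move=> s _; rewrite lee_fin le_max lexx.
Qed.

(** If [h] is continuous and piecewise C1 with derivative at most [f], where [f]
is nonnegative but possibly not measurable, then the increment of [h] is at most
the integral of [f]. *)
Lemma le_integral_piecewise a b h f (r : seq R) :
  itv_partition a b r -> {within `[a, b], continuous h} ->
  (forall s, 0 <= f s) ->
  (forall i, (i < size r)%N -> exists dh : R -> R,
     let c := nth b (a :: r) i in let d := nth b (a :: r) i.+1 in
     {within `[c, d], continuous dh} /\
     forall s, s \in `]c, d[ -> is_derive s 1 h (dh s) /\ dh s <= f s) ->
  ((h b - h a)%:E <= \int[mu]_(s in `[a, b]) (f s)%:E)%E.
Proof.
move=> rab ch f0 hr.
(* The integral of [f] need not be additive over the pieces, that of a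
   measurable minorant [k] is. *)
suff [k [mk kf hk]] : exists k : R -> R, [/\ measurable_fun setT k,
    forall s, 0 <= k s <= (f \_ `]a, b[) s &
    ((h b - h a)%:E <= \int[mu]_s (k s)%:E)%E].
  apply: le_trans hk _; rewrite [leRHS]integral_mkcond.
  apply: ge0_le_integral_nonmeasurable => [s _|s _].
    by rewrite lee_fin; case/andP: (kf s).
  have /andP[_] := kf s; rewrite -lee_fin => /le_trans; apply.
  rewrite /patch; case: ifPn => [/set_mem/subset_itv_oo_cc sab|_].
    by rewrite ifT// mem_set.
  by case: ifPn => //; rewrite lee_fin.
elim: r a rab ch hr => [|c r IH] a rab ch hr.
  exists (cst 0); split => //.
    move=> s; rewrite lexx/= /patch; case: ifP => //.
  by rewrite (itv_partition_nil rab) subrr integral0.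
have crb := itv_partition_cons rab.
have ac : a < c by case: rab => /= /andP[].
have cb := itv_partition_le crb.
have [k1 [mk1 k1f k1h]] : exists k : R -> R, [/\ measurable_fun setT k,
    forall s, 0 <= k s <= (f \_ `]a, c[) s &
    ((h c - h a)%:E <= \int[mu]_s (k s)%:E)%E].
  have [dh /= [cdh hdh]] := hr 0 (ltn0Sn _).
  apply: (positive_part_minorant ac _ cdh) => //.
  apply: continuous_subspaceW ch; exact: subset_itvl.
have [|i ir|k2 [mk2 k2f k2h]] := IH c crb.
  apply: continuous_subspaceW ch; apply: subset_itvr; exact: ltW.
  exact: (hr i.+1).
have k10 s : 0 <= k1 s by case/andP: (k1f s).
have k20 s : 0 <= k2 s by case/andP: (k2f s).
exists (k1 \+ k2); split.
- exact: measurable_funD.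
- move=> s /=; rewrite addr_ge0//=.
  have /andP[_ k1s] := k1f s; have /andP[_ k2s] := k2f s.
  apply: le_trans (lerD k1s k2s) _; rewrite /patch !mem_setE !in_itv/=.
  case: (ltgtP s c) => [sc|cs|->]; rewrite ?andbF ?andbT/=.
  + by rewrite addr0; case: (a < s); rewrite ?(lt_le_trans sc cb)//.
  + by rewrite add0r (lt_trans ac cs).
  + by rewrite addr0; case: ifP.
- under eq_integral do rewrite EFinD.
  rewrite ge0_integralD//; [|by move=> s _; rewrite lee_fin|exact/measurable_EFinP|
    by move=> s _; rewrite lee_fin|exact/measurable_EFinP].
  have -> : h b - h a = (h c - h a) + (h b - h c) by lra.
  by rewrite EFinD leeD.
Qed.

End Integration.

(** * Logarithms of affine functions along paths *)

Lemma cvg_derive1 (R : realType) (V : normedModType R) (g : R -> V) (s : R)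
    (v : V) :
  h^-1 *: (g (h + s) - g s) @[h --> (0 : R)^'] --> v -> derive1 g s = v.
Proof. by move=> gv; exact: cvg_lim. Qed.

Lemma linear_comb_continuous (R : realType) (T : topologicalType) (I : Type)
    (r : seq I) (F : I -> T -> R) (k : I -> R) :
  (forall i, continuous (F i)) -> continuous (fun u => \sum_(i <- r) F i u * k i).
Proof.
move=> cF; elim: r => [|i r IH] u.
  by under eq_fun do rewrite big_nil; exact: cvg_cst.
under eq_fun do rewrite big_cons.
by apply: cvgD; [apply: cvgM; [exact: cF|exact: cvg_cst]|exact: IH].
Qed.

Lemma cvg_is_derive1 (R : realType) (f : R -> R) (s l : R) :
  h^-1 *: (f (h + s) - f s) @[h --> (0 : R)^'] --> l -> is_derive s 1 f l.
Proof.
move=> fl.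
have fE : (fun h => h^-1 *: ((f \o shift s) (h *: 1) - f s)) =
          (fun h => h^-1 *: (f (h + s) - f s)).
  by apply/funext => h /=; rewrite [h *: 1]mulr1.
split; first by rewrite /derivable fE; apply/cvg_ex; exists l.
by rewrite /derive fE; exact: cvg_lim.
Qed.

(** At an interior point, a derivative relative to [`[a, b]] is a two-sided
derivative. *)
Lemma cvg_within_shift0 (R : realType) (V : normedModType R) (a b s : R)
    (g : R -> V) (l : V) : s \in `]a, b[ ->
  (u - s)^-1 *: (g u - g s) @[u --> within `[a, b] s^'] --> l ->
  h^-1 *: (g (h + s) - g s) @[h --> (0 : R)^'] --> l.
Proof.
rewrite in_itv/= => /andP[sa sb] /cvgrPdist_lt gl; apply/cvgrPdist_lt => e e0.
have {gl} := gl e e0; rewrite near_withinE near_withinE => -[d /= d0 gl].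
rewrite near_withinE; exists (Num.min d (Num.min (s - a) (b - s))) => /=.
  by rewrite !lt_min d0 !subr_gt0 sa sb.
move=> h /=; rewrite sub0r normrN !lt_min => /and3P[hd ha hb] h0.
have := gl (h + s); rewrite addrK; apply => //.
- by rewrite /= opprD addrCA subrr addr0 normrN.
- by rewrite -subr_eq0 addrK.
- move: ha hb; rewrite !ltr_norml in_itv/= => /andP[h1 _] /andP[_ h2].
  by apply/andP; split; lra.
Qed.

Section LogPotential.
Context {R : realType} {n : nat}.
Variables (c : 'cV[R]_n) (x0 : 'rV[R]_n).

Let L (u : 'rV[R]_n) : R := (u *m c) 0 0.
Let D z : R := 1 - L (z - x0).

Let L_continuous z : {for z, continuous L}.
Proof.
have -> : L = (fun u => \sum_(j < n) u 0 j * c j 0).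
  by apply/funext => u; rewrite /L mxE.
by apply: linear_comb_continuous => j; exact: coord_continuous.
Qed.

Let LB u v : L (u - v) = L u - L v.
Proof. by rewrite /L mulmxBl !mxE. Qed.

Let LZ k u : L (k *: u) = k * L u.
Proof. by rewrite /L -scalemxAl mxE. Qed.

Let D_continuous z : {for z, continuous D}.
Proof.
have -> : D = (fun z => 1 - (L z - L x0)) by apply/funext => w; rewrite /D LB.
have ca : continuous (fun r : R => 1 - (r - L x0)).
  move=> r; apply: cvgB; first exact: cvg_cst.
  by apply: cvgB => //; exact: cvg_cst.
exact: (@continuous_comp _ _ _ L (fun r => 1 - (r - L x0)) z
  (@L_continuous z) (@ca _)).
Qed.

Lemma log_affine_continuous (a b : R) (g : R -> 'rV[R]_n) :
  (forall s, s \in `[a, b] -> 0 < D (g s)) ->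
  {within `[a, b], continuous g} ->
  {within `[a, b], continuous (fun s => ln (D (g s)))}.
Proof.
move=> D0 /subspace_continuousP cg; apply/subspace_continuousP => s sab.
have := cg s sab => {}cg.
have cDg : D (g u) @[u --> within `[a, b] (nbhs s)] --> D (g s).
  exact: (cvg_comp _ _ cg (@D_continuous _)).
exact: (cvg_comp _ _ cDg (continuous_ln (D0 s sab))).
Qed.

Lemma dlog_affine_continuous (a b : R) (g dg : R -> 'rV[R]_n) :
  (forall s, s \in `[a, b] -> 0 < D (g s)) ->
  {within `[a, b], continuous g} -> {within `[a, b], continuous dg} ->
  {within `[a, b], continuous (fun s => L (dg s) / D (g s))}.
Proof.
move=> D0 /subspace_continuousP cg /subspace_continuousP cdg.
apply/subspace_continuousP => s sab.
apply: cvgM; first exact: (cvg_comp _ _ (cdg s sab) (@L_continuous _)).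
apply: cvgV; first by rewrite gt_eqF// D0.
exact: (cvg_comp _ _ (cg s sab) (@D_continuous _)).
Qed.

Lemma is_derive_log_affine (g : R -> 'rV[R]_n) (s : R) (v : 'rV[R]_n) :
  0 < D (g s) ->
  h^-1 *: (g (h + s) - g s) @[h --> (0 : R)^'] --> v ->
  is_derive s 1 (fun r => ln (D (g r))) (- (L v / D (g s))).
Proof.
move=> D0 gv.
have dD : is_derive s 1 (fun r => D (g r)) (- L v).
  apply: cvg_is_derive1.
  have -> : (fun h => h^-1 *: (D (g (h + s)) - D (g s))) =
            (fun h => - L (h^-1 *: (g (h + s) - g s))).
    apply/funext => h; rewrite LZ !LB /D !LB -mulrN; congr (_ * _).
    by ring.
  by apply: cvgN; exact: (cvg_comp _ _ gv (@L_continuous _)).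
have dln := is_derive1_ln D0.
have := @is_derive1_comp _ (@ln R) (fun r => D (g r)) s _ _ dln dD.
by rewrite mulrN [X in - X]mulrC.
Qed.

End LogPotential.

(** * Potentials for the weighted Funk Lagrangian and lengths of paths *)

Lemma segment_rev (R : realType) n (x y : 'rV[R]_n) s :
  segment y x (1 - s) = segment x y s.
Proof.
rewrite /segment scalerBl scale1r addrA addrCA subrr addr0.
by rewrite -scalerN opprB.
Qed.

Lemma segment0 (R : realType) n (x y : 'rV[R]_n) : segment x y 0 = x.
Proof. by rewrite /segment scale0r addr0. Qed.

Lemma segment1 (R : realType) n (x y : 'rV[R]_n) : segment x y 1 = y.
Proof. by rewrite /segment scale1r addrC subrK. Qed.

Section Main.
Context {R : realType} {n : nat}.
Variables (Om : set 'rV[R]_n) (t : R).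
Hypothesis Om_closed : closed Om.
Hypothesis Om_convex : convex_set (Om : set (convex_lmodType 'rV[R]_n)).
Hypothesis t01 : 0 <= t <= 1.
Implicit Types (x y v : 'rV[R]_n) (g dg : R -> 'rV[R]_n) (a b s : R).

Local Notation p := (funk_a_lagrangian Om t).

Lemma funk_a_lagrangian_ge0 x v : 0 <= p x v.
Proof.
case/andP: t01 => t0 t1.
by rewrite addr_ge0// mulr_ge0 ?subr_ge0//; exact: funk_lagrangian_ge0.
Qed.

(** The calibrations of the pairs (x, y) and (y, x) combine into a potential [H]
whose differential [w] minorizes the Lagrangian, with equality along the segment.
That [w] is the differential of [H] is expressed along paths, which is the form
needed to integrate. *)
Lemma funk_a_potential x y : Om° x -> Om° y ->
  exists (H : 'rV[R]_n -> R) (w : 'rV[R]_n -> 'rV[R]_n -> R),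
  [/\ H y - H x = funk_a Om t x y,
      (forall z v, Om° z -> w z v <= p z v),
      (forall s, 0 <= s <= 1 ->
        w (segment x y s) (y - x) = p (segment x y s) (y - x)) &
      [/\ (forall a b g, (forall s, s \in `[a, b] -> Om° (g s)) ->
        {within `[a, b], continuous g} ->
        {within `[a, b], continuous (H \o g)}),
      (forall a b g dg, (forall s, s \in `[a, b] -> Om° (g s)) ->
        {within `[a, b], continuous g} -> {within `[a, b], continuous dg} ->
        {within `[a, b], continuous (fun s => w (g s) (dg s))}) &
      (forall g s v, Om° (g s) ->
        h^-1 *: (g (h + s) - g s) @[h --> (0 : R)^'] --> v ->
        is_derive s 1 (H \o g) (w (g s) v))]].
Proof.
move=> Omx Omy; case/andP: t01 => t0 t1.
have [c1 /=] := calibration Om_closed Om_convex Omx Omy.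
set D1 := fun z => 1 - ((z - x) *m c1) 0 0 => -[D1_gt0 p1 seg1 F1].
have [c2 /=] := calibration Om_closed Om_convex Omy Omx.
set D2 := fun z => 1 - ((z - y) *m c2) 0 0 => -[D2_gt0 p2 seg2 F2].
exists (fun z => t * ln (D2 z) - (1 - t) * ln (D1 z)).
exists (fun z v =>
  (1 - t) * ((v *m c1) 0 0 / D1 z) - t * ((v *m c2) 0 0 / D2 z)).
have wE z v : (1 - t) * ((v *m c1) 0 0 / D1 z) - t * ((v *m c2) 0 0 / D2 z) =
    (1 - t) * ((v *m c1) 0 0 / D1 z) + t * ((- v *m c2) 0 0 / D2 z).
  by rewrite mulNmx [(- (v *m c2))%R 0 0]mxE mulNr mulrN.
split; last split.
- by rewrite /funk_a F1 F2 -/(D1 x) -/(D1 y) -/(D2 x) -/(D2 y); ring.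
- by move=> z v Omz; rewrite wE lerD// ler_wpM2l ?subr_ge0// ?p1// p2.
- move=> s s01; rewrite wE /funk_a_lagrangian seg1//; congr (_ + t * _).
  rewrite opprB -segment_rev seg2//.
  by case/andP: s01 => s0 s1; rewrite subr_ge0 s1 lerBlDr lerDl.
- move=> a b g Omg cg.
  have c1g := log_affine_continuous (fun s sab => D1_gt0 _ (Omg s sab)) cg.
  have c2g := log_affine_continuous (fun s sab => D2_gt0 _ (Omg s sab)) cg.
  move=> s; apply: cvgB; apply: cvgM; try exact: cvg_cst.
    exact: c2g.
  exact: c1g.
- move=> a b g dg Omg cg cdg.
  have c1g := dlog_affine_continuous (fun s sab => D1_gt0 _ (Omg s sab)) cg cdg.
  have c2g := dlog_affine_continuous (fun s sab => D2_gt0 _ (Omg s sab)) cg cdg.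
  move=> s; apply: cvgB; apply: cvgM; try exact: cvg_cst.
    exact: c1g.
  exact: c2g.
- move=> g s v Omg gv.
  have d1 := is_derive_log_affine (D1_gt0 _ Omg) gv.
  have d2 := is_derive_log_affine (D2_gt0 _ Omg) gv.
  have := is_deriveB (is_deriveZ t d2) (is_deriveZ (1 - t) d1).
  by move/is_derive_eq; apply; rewrite /GRing.scale/= -/(D1 _) -/(D2 _); ring.
Qed.

Lemma segment_quotient x y s u : u != s ->
  (u - s)^-1 *: (segment x y u - segment x y s) = y - x.
Proof.
move=> us; rewrite /segment opprD addrACA subrr add0r -scalerBl scalerA.
by rewrite mulVf ?scale1r// subr_eq0.
Qed.

Lemma segment_cvg x y s :
  h^-1 *: (segment x y (h + s) - segment x y s) @[h --> (0 : R)^'] --> y - x.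
Proof.
apply: cvg_near_cst; near=> h.
have h0 : h != 0 by near: h; exact: nbhs_dnbhs_neq.
have := @segment_quotient x y s (h + s).
by rewrite addrK; apply; rewrite -subr_eq0 addrK.
Unshelve. all: by end_near. Qed.

Lemma segment_within x y a b : {within `[a, b], continuous (segment x y)}.
Proof. by apply: continuous_subspaceT => s; exact: line_continuous. Qed.

Lemma segment_path x y : Om° x -> Om° y ->
  path_from_to Om° x y 0 1 (segment x y).
Proof.
move=> Omx Omy; split => //.
- split; first exact: segment_within.
  exists [:: 1]; split; first exact: itv_partition1.
  case=> // _; exists (fun=> y - x); split.
    by apply: continuous_subspaceT => s; exact: cvg_cst.
  move=> s _; apply: cvg_near_cst.
  rewrite near_withinE near_withinE; apply: nearW => u us _.
  exact: segment_quotient.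
- by move=> s; rewrite in_itv/= => s01; exact: segment_interior.
- exact: segment0.
- exact: segment1.
Qed.

Lemma segment_length x y : Om° x -> Om° y ->
  path_length p 0 1 (segment x y) = (funk_a Om t x y)%:E.
Proof.
move=> Omx Omy; have [H [w [<- _ wp [cH cw dH]]]] := funk_a_potential Omx Omy.
have Oms (s : R) : s \in `[0, 1] -> Om° (segment x y s).
  by rewrite in_itv/= => s01; exact: segment_interior.
have cs := @segment_within x y 0 1.
have cd : {within `[0 : R, 1], continuous (fun=> y - x)}.
  by apply: continuous_subspaceT => s; exact: cvg_cst.
have dHs (s : R) : s \in `]0, 1[ ->
    is_derive s 1 (H \o segment x y) (w (segment x y s) (y - x)).
  by move=> /subset_itv_oo_cc/Oms Oms'; apply: dH => //; exact: segment_cvg.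
have := integral_derivative ltr01 (cH _ _ _ Oms cs) (cw _ _ _ _ Oms cs cd) dHs.
move=> /=; rewrite segment0 segment1 => {dHs}<-.
apply: eq_integral => s; rewrite inE/= in_itv/= => s01.
by rewrite (cvg_derive1 (@segment_cvg x y s)) wp.
Qed.

Lemma le_path_length x y a b g : Om° x -> Om° y -> path_from_to Om° x y a b g ->
  ((funk_a Om t x y)%:E <= path_length p a b g)%E.
Proof.
move=> Omx Omy [ab [cg [r [rab hr]]] Omg ga gb].
have [H [w [<- wp _ [cH cw dH]]]] := funk_a_potential Omx Omy.
rewrite -ga -gb; apply: (@le_integral_piecewise _ a b (H \o g) _ r) => //.
- exact: cH.
- by move=> s; exact: funk_a_lagrangian_ge0.
move=> i ir; have [dg [cdg gdg]] := hr i ir; exists (fun s => w (g s) (dg s)) => /=.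
set c := nth b (a :: r) i; set d := nth b r i.
have sub : `[c, d] `<=` `[a, b].
  have ac : a <= c by apply: itv_partition_nth_ge rab; exact: ltnW.
  have db : d <= b by exact: (@itv_partition_nth_le _ _ _ _ _ i.+1 _ rab).
  move=> s /=; rewrite !in_itv/= => /andP[cs sd].
  by rewrite (le_trans ac cs) (le_trans sd db).
have Omcd s : s \in `[c, d] -> Om° (g s) by move=> /sub; exact: Omg.
split; first by apply: cw => //; exact: continuous_subspaceW cg.
move=> s scd; have scd' := subset_itv_oo_cc scd.
have gs := cvg_within_shift0 scd (gdg s scd').
split; first by apply: dH => //; exact: Omcd.
by rewrite (cvg_derive1 gs); apply: wp; exact: Omcd.
Qed.

End Main.

Theorem corollary6p5 (R : realType) (n : nat) (Om : set 'rV[R]_n) (t : R)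
    (Om_closed : closed Om)
    (Om_convex : convex_set (Om : set (convex_lmodType 'rV[R]_n)))
    (Om_interior : Om° !=set0)
    (t01 : 0 <= t <= 1) :
  (forall x y : 'rV[R]_n, Om° x -> Om° y ->
     (funk_a Om t x y)%:E = finsler_dist Om° (funk_a_lagrangian Om t) x y) /\
  (forall x y : 'rV[R]_n, Om° x -> Om° y ->
     minimal_path Om° (funk_a_lagrangian Om t) x y 0 1 (segment x y)).
Proof.
have dist x y : Om° x -> Om° y ->
    (funk_a Om t x y)%:E = finsler_dist Om° (funk_a_lagrangian Om t) x y.
  move=> Omx Omy; apply/eqP; rewrite eq_le; apply/andP; split.
    apply: le_ereal_inf_tmp => _ [a [b [g [pg ->]]]]; exact: le_path_length.
  apply: ereal_inf_lbound; exists 0, 1, (segment x y).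
  by split; [exact: segment_path|rewrite segment_length].
split=> // x y Omx Omy; split; first exact: segment_path.
by rewrite segment_length// dist.
Qed.
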